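(* Every cubic graph of order at least $15$ contains two vertex-disjoint cycles of different lengths.
   Context: All graphs are finite and simple; a cubic graph is a graph in which every vertex has degree $3$. The length of a cycle is its number of vertices. *)

(* Defs.v *)
From mathcomp Require Import all_boot.

Set Implicit Arguments.
Unset Strict Implicit.
Unset Printing Implicit Defensive.

Definition simple_graph (V : finType) (adj : rel V) : Prop :=
  symmetric adj /\ irreflexive adj.

Definition degree (V : finType) (adj : rel V) (x : V) : nat :=
  #|[set y | adj x y]|.

Definition cubic (V : finType) (adj : rel V) : Prop :=
  forall x : V, degree adj x = 3.

(* A cycle is given by the cyclic list of its vertices, so its length is
   [size c].  The bound on the size is needed because [ucycle] also accepts
   the empty list and, for an edge xy, the list [:: x; y]. *)
Definition graph_cycle (V : finType) (adj : rel V) (c : seq V) : Prop :=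
  ucycle adj c /\ 3 <= size c.

(* Main.v *)
Require Import Defs.
From Stdlib Require Import Classical_Prop.
From mathcomp Require Import all_boot zify.

Set Implicit Arguments.
Unset Strict Implicit.
Unset Printing Implicit Defensive.

(* Let C be a shortest cycle, of length g, and A its complement; if the claim
   fails, every cycle inside A has length g.  In a longest path v_0 v_1 ... of A
   the neighbours of v_0 in A are then among v_1 and v_(g-1).  Each vertex of C
   has at most one neighbour outside C, so at most g edges leave A.

   If g <= 4, a vertex set S <> 0 whose cycles all have length g satisfies
   10 + |S| <= 5 e(S), where e(S) counts the edges leaving S: the end of a
   longest path lies in a vertex, a triangle, a 4-cycle or a K_{2,3} joined to
   the rest of S by at most one edge, and one removes that piece.  For S = A
   this gives |V| <= 5 g - 10 + g <= 14.

   If g >= 5, shortness of C leaves every vertex of A at most one neighbour in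
   C, so v_0 is adjacent to v_(g-1), and v_0, v_1, v_(g-3), v_(g-2) have no third
   neighbour in A; hence they are adjacent to C.  As v_0 and v_1 are adjacent,
   g <= 6.  Counting also the other end of the path gives more than g edges into
   C unless the path has 5, 6 or 8 vertices, all of whose neighbours lie in the
   path and C; the remaining vertices then supply one edge too many. *)

(** * Paths inside a vertex set *)

Section Paths.

Variables (V : finType) (adj : rel V).
Hypothesis adj_sym : symmetric adj.

Definition path_in (A : {set V}) (s : seq V) : bool :=
  [&& sorted adj s, uniq s & s \subset A].

Definition longest (A : {set V}) (s : seq V) : Prop :=
  path_in A s /\ forall s', path_in A s' -> size s' <= size s.

Lemma exists_longest (A : {set V}) (x : V) :
  x \in A -> exists2 s, longest A s & 0 < size s.
Proof.
(* Tuples of a given size make existence boolean, so that a maximum below [#|V|] can be taken. *)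
move=> xA; pose P n := [exists t : n.-tuple V, path_in A t].
have inP s : path_in A s -> P (size s).
  by move=> sA; apply/existsP; exists (in_tuple s).
have P1 : path_in A [:: x] by apply/and3P; split=> //; apply/subsetP=> y /[1!inE] /eqP->.
have bound n : P n -> n <= #|V|.
  by case/existsP=> t /and3P[_ /card_uniqP tu _]; rewrite -(size_tuple t) -tu max_card.
have exP : exists n, P n by exists 1; apply: (inP _ P1).
case: (ex_maxnP exP bound) => n /existsP[t tA] nmax.
exists t; last by rewrite size_tuple; apply: (nmax 1 (inP _ P1)).
by split=> // s' /inP /nmax; rewrite size_tuple.
Qed.

Lemma longest_rev A s : longest A s -> longest A (rev s).
Proof.
case=> /and3P[s1 s2 s3] smax; split=> [|s']; last by rewrite size_rev; apply: smax.
apply/and3P; split; rewrite ?rev_uniq //; last by apply/subsetP=> y /[!mem_rev];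
  apply/subsetP.
by rewrite rev_sorted (eq_sorted (e' := adj)) // => y z; rewrite adj_sym.
Qed.

Lemma sorted_adj x0 s i j : sorted adj s -> (j == i.+1) || (i == j.+1) ->
  i < size s -> j < size s -> adj (nth x0 s i) (nth x0 s j).
Proof.
move=> /(sortedP x0) ss /orP[] /eqP-> ? ?; first exact: ss.
by rewrite adj_sym; apply: ss.
Qed.

(** The chord closes up the segment of the path between its two ends. *)
Lemma chord_cycle x0 A s i j : path_in A s -> i.+2 <= j -> j < size s ->
    adj (nth x0 s i) (nth x0 s j) ->
  exists c : seq V, [/\ graph_cycle adj c, c \subset A & size c = (j - i).+1].
Proof.
move=> /and3P[s1 s2 s3] ij js aij; pose c := take (j - i).+1 (drop i s).
have sz : size c = (j - i).+1 by rewrite size_take size_drop; case: ifP; lia.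
exists c; split=> //; last first.
  by apply/subsetP=> y /mem_take /mem_drop; apply/subsetP.
have cs : sorted adj c by apply/take_sorted/drop_sorted.
split; last by rewrite sz; lia.
apply/andP; split; last by apply/take_uniq/drop_uniq.
have lc : last x0 c = nth x0 s j.
  by rewrite (last_nth x0) sz /= nth_take // nth_drop; congr nth; lia.
have hc : nth x0 c 0 = nth x0 s i by rewrite nth_take // nth_drop addn0.
rewrite (cycle_path x0) lc; case: (c) cs hc => //= y c' -> ->.
by rewrite adj_sym aij.
Qed.

(** * Neighbours of the end of a longest path *)

Section LongestPath.

Variables (x0 : V) (A : {set V}) (s : seq V).
Hypothesis s_longest : longest A s.
Let v i := nth x0 s i.

Lemma longest_mem i : i < size s -> v i \in A.
Proof. by case: s_longest => /and3P[_ _ /subsetP sA] _ ?; apply/sA/mem_nth. Qed.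

Lemma longest_step i j : (j == i.+1) || (i == j.+1) ->
  i < size s -> j < size s -> adj (v i) (v j).
Proof. by case: s_longest => /and3P[s1 _ _] _; apply: sorted_adj. Qed.

Lemma longest_inj i j : i < size s -> j < size s -> v i = v j -> i = j.
Proof.
case: s_longest => /and3P[_ s2 _] _ ? ? /eqP; rewrite nth_uniq //.
by move/eqP.
Qed.

(** Otherwise [y] could be put in front of the path. *)
Lemma longest_head_nbr y : 0 < size s -> y \in A -> adj (v 0) y -> y \in s.
Proof.
case: s_longest => /and3P[s1 s2 s3] smax; rewrite /v; case: s s1 s2 s3 smax => //= z t.
move=> s1 s2 s3 smax _ yA zy; apply: contraT => yt.
have /smax : path_in A (y :: z :: t); last by rewrite /= ltnn.
apply/and3P; split => /=; rewrite ?yt //; first by rewrite adj_sym zy.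
by apply/subsetP=> u /[1!inE] /predU1P[->//|]; apply/subsetP.
Qed.

(* Posa's rotation *)
Lemma longest_rot m : 0 < m < size s -> adj (v 0) (v m) ->
  longest A (rev (take m s) ++ drop m s).
Proof.
case: s_longest => /and3P[s1 s2 s3] smax /andP[m0 ms] a0m.
have mem_rot y : (y \in rev (take m s) ++ drop m s) = (y \in s).
  by rewrite mem_cat mem_rev -mem_cat cat_take_drop.
have szr : size (rev (take m s) ++ drop m s) = size s.
  by rewrite size_cat size_rev -size_cat cat_take_drop.
split; last by move=> s' /smax; rewrite szr.
apply/and3P; split; last by apply/subsetP=> y; rewrite mem_rot; apply/subsetP.
  have -> : rev (take m s) = rcons (rev (behead (take m s))) (v 0).
    rewrite /v; case: (s) m m0 ms {a0m mem_rot szr} => //= z t [//|m] _ _ /=.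
    by rewrite rev_cons.
  rewrite (drop_nth x0) // cat_rcons sorted_cat_cons /= a0m.
  apply/andP; split.
    rewrite -rev_cons rev_sorted (eq_sorted (e' := adj)); last by move=> y z /=;
      rewrite adj_sym.
    have := take_sorted m s1.
    by rewrite /v; case: (s) m m0 ms {a0m mem_rot szr} => //= z t [//|m] _ _ /=.
  by have := drop_sorted m s1; rewrite (drop_nth x0).
rewrite cat_uniq rev_uniq take_uniq ?drop_uniq //= andbT.
have := s2; rewrite -{1}(cat_take_drop m s) cat_uniq => /and3P[_ /hasPn h _].
by apply/hasPn=> y /h /=; rewrite mem_rev.
Qed.

(** The rotated path starts at [v (m - 1)]; with [m = g - 1], facts about the head thus transfer to
    [v (g - 2)]. *)
Lemma nth_rot_path m i : m < size s ->
  nth x0 (rev (take m s) ++ drop m s) i = if i < m then v (m - i.+1) else v i.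
Proof.
move=> ms; rewrite nth_cat size_rev size_takel ?(ltnW ms) //; case: ltnP => im.
  by rewrite nth_rev size_takel ?(ltnW ms) // nth_take //; lia.
by rewrite nth_drop subnKC.
Qed.

Variable g : nat.
Hypothesis cyclesA : forall c, graph_cycle adj c -> c \subset A -> size c = g.

Lemma longest_chord i j : i.+2 <= j -> j < size s -> adj (v i) (v j) ->
  j = i + g.-1.
Proof.
case: s_longest => sp _ ij js aij.
have [c [gc cA cs]] := chord_cycle sp ij js aij.
by have := cyclesA gc cA; rewrite cs; lia.
Qed.

Lemma longest_head y : 0 < size s -> y \in A -> adj (v 0) y -> irreflexive adj ->
  1 < size s /\ (y = v 1 \/ [/\ 2 < g, g <= size s & y = v g.-1]).
Proof.
move=> s0 yA ay irr; have /(nthP x0) [j js jy] := longest_head_nbr s0 yA ay.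
rewrite -/(v j) in jy; rewrite -{}jy in ay *.
case: j js ay => [|[|j]] js ay; first by rewrite irr in ay.
  by split=> //; left.
have {}js : j.+2 < size s := js.
split; first by lia.
have := longest_chord _ js ay => /(_ isT) ?; right; split; try lia.
by congr v; lia.
Qed.

(** Replacing the head keeps the size, so every fact about heads of longest paths applies to [w]. *)
Lemma longest_swap w : 1 < size s -> w \in A -> w \notin s -> adj w (v 1) ->
  longest A (w :: behead s).
Proof.
case: s_longest => /and3P[s1 s2 s3] smax; rewrite /v.
case: s s1 s2 s3 smax => [|z [|y t]] //= /andP[_ s1] /andP[_ s2] s3 smax _ wA.
rewrite inE => /norP[_ wt] wy; split=> //=.
apply/and3P; split; rewrite /= ?wy ?wt //.
apply/subsetP=> u; rewrite inE => /predU1P[->//|ut].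
by apply: (subsetP s3); rewrite inE ut orbT.
Qed.

End LongestPath.

(** * Neighbourhoods and edge boundaries in a cubic graph *)

Section Cubic.

Hypotheses (adj_irr : irreflexive adj) (adj_cubic : cubic adj).

Let nb x := [set y | adj x y].

Lemma third_nbr x a b : adj x a -> adj x b -> a != b ->
  exists c, [/\ adj x c, c != a, c != b & forall w, adj x w -> w \in [:: a; b; c]].
Proof.
move=> xa xb ab; have := adj_cubic x; rewrite /degree -/(nb x) (cardsD1 a) (cardsD1 b).
rewrite !inE xa xb eq_sym ab => -[] /eqP/cards1P[c xc].
have inc w : (w == c) = [&& w != b, w != a & adj x w].
  by have := in_set1 w c; rewrite -xc !inE.
have := inc c; rewrite eqxx => /esym/and3P[cb ca xc']; exists c; split=> // w xw.
by rewrite !inE inc xw; case: (w == a); case: (w == b).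
Qed.

Lemma three_nbrs x a b c w : adj x a -> adj x b -> adj x c -> uniq [:: a; b; c] ->
  adj x w -> w \in [:: a; b; c].
Proof.
move=> xa xb xc /and3P[] /[!inE] /norP[ab ac] bc _.
have [d [xd _ _ H]] := third_nbr xa xb ab => /H.
by have := H _ xc; rewrite !inE eq_sym (negPf ac) eq_sym (negPf bc) => /eqP->.
Qed.

(** At most two of the three edges at [x] stay in [A]; [a] and [b] may coincide. *)
Lemma nbr_outside (A : {set V}) x a b :
    (forall w, w \in A -> adj x w -> w \in [:: a; b]) ->
  exists2 y, y \notin A & adj x y.
Proof.
move=> H; have [/subsetP xA|/subsetPn[y]] := boolP (nb x \subset A); last first.
  by rewrite inE => xy yA; exists y.
have : size (enum (nb x)) <= 2.
  rewrite -[2]/(size [:: a; b]) uniq_leq_size ?enum_uniq // => y.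
  by rewrite mem_enum => xy; apply: H; [apply: xA | rewrite inE in xy].
by rewrite -cardE; have := adj_cubic x; rewrite /degree -/(nb x) => ->.
Qed.

Definition boundary (A : {set V}) := \sum_(x in A) #|nb x :\: A|.

Lemma edges_between_sym (A B : {set V}) :
  \sum_(x in A) #|nb x :&: B| = \sum_(y in B) #|nb y :&: A|.
Proof.
transitivity (\sum_(x in A) \sum_(y in B) (adj x y : nat)); last first.
  rewrite exchange_big; apply: eq_bigr => y yB.
  rewrite -sum1dep_card big_mkcond [RHS]big_mkcond; apply: eq_bigr => x _.
  by rewrite !inE adj_sym; case: (x \in A); case: adj.
apply: eq_bigr => y yB.
rewrite -sum1dep_card big_mkcond [RHS]big_mkcond; apply: eq_bigr => x _.
by rewrite !inE; case: (x \in B); case: adj.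
Qed.

(** An edge between [N] and [A :\: N] counts in both boundaries on the right and not in
    [boundary A]; any other edge leaving a part leaves [A]. *)
Lemma boundary_cut (A N : {set V}) : N \subset A ->
  boundary A + (\sum_(x in N) #|nb x :&: (A :\: N)|).*2
    = boundary (A :\: N) + boundary N.
Proof.
move=> NA; have splitD (B C D : {set V}) : C \subset B -> D = B :\: C ->
    forall x, #|nb x :\: C| = #|nb x :\: B| + #|nb x :&: D|.
  move=> CB -> x; rewrite -(cardsID B (nb x :\: C)) addnC; congr (_ + _).
    by apply: eq_card => y; rewrite !inE; have := subsetP CB y;
      case: (y \in C) => [->//|_]; rewrite ?andbF //=; case: (y \in B); case: adj.
  by apply: eq_card => y; rewrite !inE; case: (y \in B); case: (y \in C); case: adj.
have -> : boundary (A :\: N) = \sum_(x in A :\: N) (#|nb x :\: A| + #|nb x :&: N|).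
  apply: eq_bigr => x _; apply: splitD; first exact: subsetDl.
  by apply/setP=> y; rewrite !inE; have := subsetP NA y; case: (y \in N) => [->//|_];
    case: (y \in A).
have -> : boundary N = \sum_(x in N) (#|nb x :\: A| + #|nb x :&: (A :\: N)|).
  by apply: eq_bigr => x _; apply: splitD.
rewrite !big_split /= (edges_between_sym (A :\: N) N).
rewrite /boundary (big_setID N) /= (setIidPr NA) -addnn; lia.
Qed.

Lemma boundary_ge (A : {set V}) (l : seq V) : uniq l ->
    (forall x, x \in l -> x \in A /\ exists2 y, y \notin A & adj x y) ->
  size l <= boundary A.
Proof.
move=> ul lA; rewrite /boundary -(card_uniqP ul) -sum1_card.
rewrite [X in _ <= X]big_mkcond [X in X <= _]big_mkcond; apply: leq_sum => x _.
case: ifP => // /lA[-> [y yA xy]]; rewrite card_gt0.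
by apply/set0Pn; exists y; rewrite !inE yA.
Qed.

(** Only the edge [z w] may join [l] to the rest, so cutting it off raises the total boundary by at
    most 2. If both parts are nonempty, adding their bounds gives
    [20 + #|A| <= 5 * (boundary A + 2)]: the constant 10 pays for that edge. *)
Lemma leaf_bound (A : {set V}) (l : seq V) z w :
    {subset l <= A} -> l != [::] -> size l <= 5 ->
    (forall B : {set V}, B \proper A -> 0 < #|B| -> 10 + #|B| <= 5 * boundary B) ->
    (forall x y, x \in l -> y \in A -> y \notin l -> adj x y -> x = z /\ y = w) ->
    ({subset A <= l} -> 3 <= boundary A) ->
  10 + #|A| <= 5 * boundary A.
Proof.
move=> lA l0 sl IH H1 H3; pose N := [set x in l].
have NA : N \subset A by apply/subsetP=> x /[1!inE] /lA.
have N0 : 0 < #|N|.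
  by case: (l) l0 @N {H1 H3 lA sl NA} => //= x t _; rewrite card_gt0; apply/set0Pn;
    exists x; rewrite !inE eqxx.
have N5 : #|N| <= 5 by rewrite cardsE (leq_trans (card_size l)).
have cA : #|A| = #|A :\: N| + #|N| by rewrite -(cardsID N A) (setIidPr NA) addnC.
have [AN|AN] := posnP #|A :\: N|.
  (* The piece is all of [A] and has at most 5 vertices, so [10 + 5 = 5 * 3] suffices. *)
  suff : 3 <= boundary A by lia.
  apply: H3 => x xA; move/eqP: AN; rewrite cards_eq0 setD_eq0 => /subsetP/(_ x xA).
  by rewrite inE.
have pN : N \proper A by rewrite properEcard NA; lia.
have pD : A :\: N \proper A by rewrite properEcard subsetDl; lia.
have := boundary_cut NA; have := IH _ pN N0; have := IH _ pD AN.
suff : \sum_(x in N) #|nb x :&: (A :\: N)| <= 1 by lia.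
(* The sum is compared termwise with the indicator of [z]. *)
have -> : 1 = \sum_x (x == z : nat) by rewrite (bigD1 z) //= eqxx big1 // => x /negPf->.
rewrite big_mkcond; apply: leq_sum => x _; case: ifP => // xl; rewrite inE in xl.
case: eqP => xz.
  apply: (@leq_trans #|[set w]|); last by rewrite cards1.
  apply/subset_leq_card/subsetP=> y /[!inE] /and3P[xy yl yA].
  by have [_ ->] := H1 x y xl yA yl xy.
rewrite leqn0 cards_eq0 -subset0; apply/subsetP=> y /[!inE] /and3P[xy yl yA].
by have [] := H1 x y xl yA yl xy.
Qed.

(** * Cutting off a vertex, a triangle, a square or a [K_{2,3}] *)

Section LeafRemoval.

Variables (x0 : V) (g : nat) (A : {set V}).
Hypothesis cyclesA : forall c, graph_cycle adj c -> c \subset A -> size c = g.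
Hypothesis IH :
  forall B : {set V}, B \proper A -> 0 < #|B| -> 10 + #|B| <= 5 * boundary B.

Let adj_neq x y : adj x y -> x != y.
Proof. by apply: contraTneq => ->; rewrite adj_irr. Qed.

(** Without the closing chord, the only possible neighbour of the head in [A] is [v 1], so the head
    is cut off alone. *)
Lemma open_end_bound s : longest A s -> 0 < size s ->
    ~~ [&& 2 < g, g <= size s & adj (nth x0 s 0) (nth x0 s g.-1)] ->
  10 + #|A| <= 5 * boundary A.
Proof.
move=> sl s0 nclose;
  apply: (@leaf_bound A [:: nth x0 s 0] (nth x0 s 0) (nth x0 s 1)) => //.
- by move=> x /[1!inE] /eqP->; apply: (longest_mem _ sl s0).
- move=> x y /[1!inE] /eqP-> yA _ ay; split=> //.
  have [_ [//|[g3 gs yE]]] := longest_head sl cyclesA s0 yA ay adj_irr.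
  by move: nclose; rewrite g3 gs -yE ay.
- move=> AE; have -> : A = [set nth x0 s 0].
    apply/eqP; rewrite eq_sym eqEsubset; apply/andP; split; apply/subsetP=> x; last first.
      by move/AE; rewrite !inE.
    by move/set1P->; apply: (longest_mem _ sl s0).
  rewrite /boundary big_set1 -(adj_cubic (nth x0 s 0)) subset_leq_card //.
  by apply/subsetP=> y /[!inE] xy; rewrite xy andbT eq_sym adj_neq.
Qed.

Hypothesis closes : forall s, longest A s -> 0 < size s ->
  [/\ 2 < g, g <= size s & adj (nth x0 s 0) (nth x0 s g.-1)].

Lemma longest_end_nbrs s y : longest A s -> 0 < size s -> y \in A ->
  adj (nth x0 s 0) y -> y \in [:: nth x0 s 1; nth x0 s g.-1].
Proof.
move=> sl s0 yA ay; rewrite !inE.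
by have [_ [->|[_ _ ->]]] := longest_head sl cyclesA s0 yA ay adj_irr; rewrite eqxx ?orbT.
Qed.

Variable s : seq V.
Hypotheses (s_longest : longest A s) (s_gt0 : 0 < size s).
Let v i := nth x0 s i.

(** Rotation along the closing chord makes [v (g - 2)] the head of a longest path. *)
Lemma rot_end_nbrs y : y \in A -> adj (v g.-2) y -> y \in [:: v g.-1.-2; v g.-1].
Proof.
have [g3 gs ag] := closes s_longest s_gt0.
have gm : 0 < g.-1 < size s by lia.
have rl := longest_rot s_longest gm ag.
have r0 : 0 < size (rev (take g.-1 s) ++ drop g.-1 s).
  by rewrite size_cat size_drop; lia.
have := longest_end_nbrs rl r0 (y := y); rewrite !nth_rot_path; try lia.
have -> : 0 < g.-1 by lia.
have -> : 1 < g.-1 by lia.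
by rewrite ltnn subn1 subn2.
Qed.

Let v_mem k i : k <= size s -> i < k -> v i \in A.
Proof. by move=> ks ik; apply: (longest_mem _ s_longest); apply: leq_trans ks. Qed.

Let v_adj k i : k <= size s -> i.+1 < k -> adj (v i) (v i.+1).
Proof.
by move=> ks ik; apply: (longest_step x0 s_longest); rewrite ?eqxx //; lia.
Qed.

Let v_neq k i j : k <= size s -> i < k -> j < k -> i != j -> v i != v j.
Proof.
move=> ks ik jk; apply: contra_neq; apply: (longest_inj s_longest); lia.
Qed.

(** The heads before and after rotation are [v 0] and [v 1], so only [v 2] can have an edge to the
    rest of [A]. *)
Lemma triangle_bound : g = 3 -> 10 + #|A| <= 5 * boundary A.
Proof.
move=> gE; have [_ gs ag] := closes s_longest s_gt0.
have hd y := longest_end_nbrs s_longest s_gt0 (y := y); have hdr := rot_end_nbrs.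
rewrite -!/(v _) {}gE /= in gs ag hd hdr.
have vA i := v_mem (i := i) gs; have vneq i j := v_neq (i := i) (j := j) gs.
have a01 : adj (v 0) (v 1) by apply: v_adj gs _.
have a12 : adj (v 1) (v 2) by apply: v_adj gs _.
have [w [_ _ _ h2]] : exists w, [/\ adj (v 2) w, w != v 0, w != v 1 &
    forall y, adj (v 2) y -> y \in [:: v 0; v 1; w]].
  by apply: third_nbr; rewrite 1?adj_sym // vneq.
apply: (@leaf_bound A [:: v 0; v 1; v 2] (v 2) w) => //.
- by move=> x; rewrite !inE => /or3P[]/eqP->; apply: vA.
- move=> x y; rewrite !inE => /or3P[]/eqP-> yA yn ay.
  + by have := hd _ yA ay; rewrite !inE => /orP[] E; rewrite E ?orbT in yn.
  + by have := hdr _ yA ay; rewrite !inE => /orP[] E; rewrite E ?orbT in yn.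
  + by have := h2 _ ay; rewrite !inE => /or3P[] E; rewrite ?E ?orbT // in yn;
    rewrite (eqP E).
move=> AE; apply: (@boundary_ge A [:: v 0; v 1; v 2]) => //.
  by rewrite /= !inE !negb_or !vneq.
move=> x; rewrite !inE => /or3P[]/eqP->; rewrite vA //; split=> //.
- exact: nbr_outside hd.
- exact: nbr_outside hdr.
- apply: (@nbr_outside A _ (v 0) (v 1)) => y yA ay.
  have := AE _ yA; rewrite !inE => /or3P[->|->|/eqP E]; rewrite ?orbT //.
  by rewrite E adj_irr in ay.
Qed.

(** In [A], the heads [v 0] and [v 2] before and after rotation see only [v 1] and [v 3]. The third
    neighbour [w] of [v 1] decides the piece: a square if [w] is outside [A], else a [K_{2,3}]. *)
Lemma square_bound : g = 4 -> 10 + #|A| <= 5 * boundary A.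
Proof.
move=> gE; have [_ gs ag] := closes s_longest s_gt0.
have hd y := longest_end_nbrs s_longest s_gt0 (y := y); have hdr := rot_end_nbrs.
rewrite -!/(v _) gE /= in gs ag hd hdr.
have vA i := v_mem (i := i) gs; have vneq i j := v_neq (i := i) (j := j) gs.
have a01 : adj (v 0) (v 1) by apply: v_adj gs _.
have a12 : adj (v 1) (v 2) by apply: v_adj gs _.
have a23 : adj (v 2) (v 3) by apply: v_adj gs _.
have [w [aw w0 w2 h1]] : exists w, [/\ adj (v 1) w, w != v 0, w != v 2 &
    forall y, adj (v 1) y -> y \in [:: v 0; v 2; w]].
  by apply: third_nbr => //; rewrite 1?adj_sym // vneq.
have [wA|wA] := boolP (w \in A); last first.
  have [w' [_ _ _ h3]] : exists w, [/\ adj (v 3) w, w != v 0, w != v 2 &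
      forall y, adj (v 3) y -> y \in [:: v 0; v 2; w]].
    by apply: third_nbr => //; rewrite 1?adj_sym // vneq.
  apply: (@leaf_bound A [:: v 0; v 1; v 2; v 3] (v 3) w') => //.
  - by move=> x; rewrite !inE => /or4P[]/eqP->; apply: vA.
  - move=> x y; rewrite !inE => /or4P[]/eqP-> yA yn ay.
    + by have := hd _ yA ay; rewrite !inE => /orP[] E; rewrite E ?orbT in yn.
    + have := h1 _ ay; rewrite !inE => /or3P[] E; rewrite ?E ?orbT // in yn.
      by rewrite -(eqP E) yA in wA.
    + by have := hdr _ yA ay; rewrite !inE => /orP[] E; rewrite E ?orbT in yn.
    + by have := h3 _ ay; rewrite !inE => /or3P[] E; rewrite ?E ?orbT // in yn;
      rewrite (eqP E).
  move=> AE; apply: (@boundary_ge A [:: v 0; v 1; v 2]) => //.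
    by rewrite /= !inE !negb_or !vneq.
  move=> x; rewrite !inE => /or3P[]/eqP->; rewrite vA //; split=> //.
  - exact: nbr_outside hd.
  - by exists w.
  - exact: nbr_outside hdr.
(* On the path, [w] must be [v 4], as the chord from [v 1] spans [g - 1 = 3] steps; only [v 4] can
   then lead to the rest of [A]. *)
have [ws|ws] := boolP (w \in s).
  have /(nthP x0)[j js jw] := ws; rewrite -/(v j) in jw.
  have j4 : j = 4.
    rewrite -{}jw in w0 w2 aw; have := longest_chord s_longest cyclesA _ js aw.
    rewrite gE; case: j js w0 w2 aw => [|[|[|j]]] js; rewrite ?eqxx ?adj_irr // => _ _ aw.
    by move=> ->.
  have g5 : 4 < size s by rewrite -j4.
  rewrite {j js}j4 in jw; rewrite -{w ws wA}jw in h1 aw w0 w2.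
  have {}vA i := v_mem (i := i) g5; have {}vneq i j := v_neq (i := i) (j := j) g5.
  have a34 : adj (v 3) (v 4) by apply: v_adj g5 _.
  have h3 y : adj (v 3) y -> y \in [:: v 0; v 2; v 4].
    by apply: three_nbrs => //; rewrite 1?adj_sym //= !inE !negb_or !vneq.
  have [w' [_ _ _ h4]] : exists w, [/\ adj (v 4) w, w != v 1, w != v 3 &
      forall y, adj (v 4) y -> y \in [:: v 1; v 3; w]].
    by apply: third_nbr => //; rewrite 1?adj_sym // vneq.
  apply: (@leaf_bound A [:: v 0; v 1; v 2; v 3; v 4] (v 4) w') => //.
  - by move=> x; rewrite !inE => /orP[|/or4P[]]/eqP->; apply: vA.
  - move=> x y; rewrite !inE => /orP[|/or4P[]]/eqP-> yA yn ay.
    + by have := hd _ yA ay; rewrite !inE => /orP[] E; rewrite E ?orbT in yn.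
    + by have := h1 _ ay; rewrite !inE => /or3P[] E; rewrite E ?orbT in yn.
    + by have := hdr _ yA ay; rewrite !inE => /orP[] E; rewrite E ?orbT in yn.
    + by have := h3 _ ay; rewrite !inE => /or3P[] E; rewrite E ?orbT in yn.
    + by have := h4 _ ay; rewrite !inE => /or3P[] E; rewrite ?E ?orbT // in yn;
      rewrite (eqP E).
  move=> AE; apply: (@boundary_ge A [:: v 0; v 2; v 4]) => //.
    by rewrite /= !inE !negb_or !vneq.
  move=> x; rewrite !inE => /or3P[]/eqP->; rewrite vA //; split=> //.
  - exact: nbr_outside hd.
  - exact: nbr_outside hdr.
  - apply: (@nbr_outside A _ (v 1) (v 3)) => y yA ay.
    have v4A : v 4 \in A by apply: vA.
    have := AE _ yA; rewrite !inE => /orP[/eqP E|/or4P[->|/eqP E|->|/eqP E]];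
      rewrite ?orbT //.
    + have : adj (v 0) (v 4) by rewrite adj_sym -E.
      by move/(hd _ v4A); rewrite !inE (negPf (vneq 4 1 _ _ _)) ?(negPf (vneq 4 3 _ _ _)).
    + have : adj (v 2) (v 4) by rewrite adj_sym -E.
      by move/(hdr _ v4A);
        rewrite !inE (negPf (vneq 4 1 _ _ _)) ?(negPf (vneq 4 3 _ _ _)).
    + by rewrite E adj_irr in ay.
(* Off the path, [w] can replace [v 0] as head; the closing chord of the new path joins it to
   [v 3]. *)
have s1 : 1 < size s by apply: leq_trans gs.
have wl : longest A (w :: behead s).
  by apply: (longest_swap (x0 := x0) s_longest); rewrite ?(adj_sym w).
have aw3 : adj w (v 3).
  by have [//|_ _] := closes wl; rewrite gE /= nth_behead.
have hw y : y \in A -> adj w y -> y \in [:: v 1; v 3].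
  by move=> yA ay; have := longest_end_nbrs wl isT yA ay; rewrite gE /= !nth_behead.
have h3 y : adj (v 3) y -> y \in [:: v 0; v 2; w].
  apply: three_nbrs => //; rewrite 1?adj_sym //= !inE !negb_or !vneq //.
  by rewrite ![v _ == w]eq_sym w0 w2.
(* No edge joins these five vertices to the rest of [A]; [w w] is a dummy for the joining edge. *)
apply: (@leaf_bound A [:: v 0; v 1; v 2; v 3; w] w w) => //.
- by move=> x; rewrite !inE => /orP[|/or4P[]]/eqP-> //; apply: vA.
- move=> x y; rewrite !inE => /orP[|/or4P[]]/eqP-> yA yn ay.
  + by have := hd _ yA ay; rewrite !inE => /orP[] E; rewrite E ?orbT in yn.
  + by have := h1 _ ay; rewrite !inE => /or3P[] E; rewrite E ?orbT in yn.
  + by have := hdr _ yA ay; rewrite !inE => /orP[] E; rewrite E ?orbT in yn.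
  + by have := h3 _ ay; rewrite !inE => /or3P[] E; rewrite E ?orbT in yn.
  + by have := hw _ yA ay; rewrite !inE => /orP[] E; rewrite E ?orbT in yn.
move=> AE; apply: (@boundary_ge A [:: v 0; v 2; w]) => //.
  by rewrite /= !inE !negb_or !vneq //; rewrite ![v _ == w]eq_sym w0 w2.
move=> x; rewrite !inE => /or3P[]/eqP->; rewrite ?vA //; split=> //.
- exact: nbr_outside hd.
- exact: nbr_outside hdr.
- exact: nbr_outside hw.
Qed.

End LeafRemoval.

Lemma boundary_bound g (A : {set V}) : g <= 4 ->
    (forall c, graph_cycle adj c -> c \subset A -> size c = g) ->
  0 < #|A| -> 10 + #|A| <= 5 * boundary A.
Proof.
move=> g4; have [n nA] := ubnP #|A|; elim: n => // n IHn in A nA *.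
move=> cyclesA A0.
have IH (B : {set V}) : B \proper A -> 0 < #|B| -> 10 + #|B| <= 5 * boundary B.
  move=> BA B0; apply: IHn => // [|c cB BB]; first by have := proper_card BA; lia.
  by apply: cyclesA cB (subset_trans BB (proper_sub BA)).
have [x0 x0A] : exists x, x \in A by apply/set0Pn; rewrite -card_gt0.
apply: contraT => notA.
have closes s : longest A s -> 0 < size s ->
    [/\ 2 < g, g <= size s & adj (nth x0 s 0) (nth x0 s g.-1)].
  by move=> sl s0; apply/and3P; apply: contraR notA; apply: open_end_bound.
have [s sl s0] := exists_longest x0A; have [g3 _ _] := closes s sl s0.
have [gE|gE] : g = 3 \/ g = 4 by lia.
  by case/negP: notA; apply: (triangle_bound cyclesA IH closes sl s0 gE).
by case/negP: notA; apply: (square_bound cyclesA IH closes sl s0 gE).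
Qed.


(** * Edges at a shortest cycle *)

Section ShortestCycle.

Variables (C : seq V).
Hypothesis C_cycle : graph_cycle adj C.
Hypothesis C_shortest : forall c, graph_cycle adj c -> size C <= size c.

(** This is a shorter one of the two arcs of [C]; [size p] is its number of edges. *)
Lemma cycle_arc a b : a \in C -> b \in C -> a != b ->
  exists p : seq V, [/\ path adj a p, last a p = b, uniq (a :: p),
                {subset a :: p <= C} & 2 * size p <= size C].
Proof.
case: C_cycle => /andP[cC uC] _ aC bC ab.
have [i p1 p2 _ _ rC] := rot_to_arc uC aC bC ab.
have memC y : (y \in C) = (y \in a :: p1 ++ b :: p2) by rewrite -(mem_rot i) rC.
have := cC; have := uC; rewrite -(rot_cycle i) -(rot_uniq i) rC.
have -> : size C = (size p1 + size p2).+2.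
  by rewrite -(size_rot i) rC /= size_cat /= addnS.
rewrite /= rcons_cat /= cat_path /= rcons_path.
rewrite mem_cat inE negb_or cat_uniq /= !negb_or.
case/and4P=> /andP[ap1 /andP[_ ap2]] up1 /andP[bp1 _] /andP[bp2 up2].
case/and4P=> pp1 pb pp2 pa.
have [le12|le21] := leqP (size p1) (size p2).
  exists (rcons p1 b); split; rewrite ?last_rcons ?rcons_path ?pp1 //=.
  - by rewrite mem_rcons inE negb_or ab ap1 rcons_uniq bp1.
  - move=> y; rewrite memC !inE mem_rcons mem_cat !inE.
    by move=> /or3P[]->; rewrite ?orbT.
  - by rewrite size_rcons mulnS mul2n -addnn !ltnS leq_add2l.
have pr : path adj a (rev (b :: p2)).
  have := rev_path adj b (rcons p2 a); rewrite last_rcons belast_rcons => ->.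
  by rewrite (eq_path (e' := adj)) ?rcons_path ?pp2 // => y z; rewrite adj_sym.
exists (rev (b :: p2)); split=> //.
- by rewrite rev_cons last_rcons.
- by rewrite /= mem_rev rev_uniq /= /= inE negb_or ab ap2 bp2.
- by move=> y; rewrite memC !inE mem_rev mem_cat !inE => /or3P[]->; rewrite ?orbT.
- by rewrite size_rev /= mulnS mul2n -addnn !ltnS leq_add2r ltnW.
Qed.

(** A shorter arc and [x] form a cycle with at most [size C / 2 + 2] vertices. *)
Lemma cycle_touched_twice x a b : x \notin C -> a \in C -> b \in C -> a != b ->
  adj x a -> adj x b -> size C <= 4.
Proof.
move=> xC aC bC ab xa xb; have [p [pp lp up pC sp]] := cycle_arc aC bC ab.
suff h : graph_cycle adj (x :: a :: p).
  by move: (C_shortest h) sp => /=; move: (size C) (size p) => m n; clear; lia.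
split; last by case: (p) lp ab => //= ->; rewrite eqxx.
apply/andP; split; first by rewrite /= xa rcons_path pp lp adj_sym.
by rewrite cons_uniq up andbT; apply: contra xC => /pC.
Qed.

(** Here the cycle through the arc has at most [size C / 2 + 3] vertices. *)
Lemma cycle_touched_adj x y a b : x \notin C -> y \notin C -> adj x y ->
  a \in C -> b \in C -> a != b -> adj x a -> adj y b -> size C <= 6.
Proof.
move=> xC yC xy aC bC ab xa yb; have [p [pp lp up pC sp]] := cycle_arc aC bC ab.
suff h : graph_cycle adj (y :: x :: a :: p).
  by move: (C_shortest h) sp => /=; move: (size C) (size p) => m n; clear; lia.
split=> //; apply/andP; split.
  by rewrite /= xa rcons_path pp lp (adj_sym y x) xy adj_sym yb.
rewrite 2!cons_uniq up andbT inE negb_or -andbA; apply/and3P; split.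
- by apply: contraTneq xy => ->; rewrite adj_irr.
- by apply: contra yC => /pC.
- by apply: contra xC => /pC.
Qed.

(** Two of the three edges at [a] belong to the cycle. *)
Lemma cycle_outer_nbr a y z : a \in C -> y \notin C -> z \notin C ->
  adj a y -> adj a z -> y = z.
Proof.
case: C_cycle => /andP[cC uC] C3 aC yC zC ay az.
have [i t rC] := rot_to aC; have memC u : (u \in C) = (u \in a :: t).
  by rewrite -(mem_rot i) rC.
have := cC; have := uC; rewrite -(rot_cycle i) -(rot_uniq i) rC.
have : 2 < size (a :: t) by rewrite -rC size_rot.
case: t memC {rC} => [|b [|c t]] // memC _ ut /=.
rewrite rcons_path => /and4P[ab _ _ la].
have bl : b != last c t.
  have /and3P[_ /= bn _] := ut; apply: contraNneq bn => ->.
  exact: mem_last.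
have [w [_ _ _ H]] : exists w, [/\ adj a w, w != b, w != last c t &
    forall u, adj a u -> u \in [:: b; last c t; w]].
  by apply: third_nbr => //; rewrite adj_sym.
have only_w u : u \notin C -> adj a u -> u = w.
  move=> uC' /H; rewrite !inE => /or3P[/eqP E|/eqP E|/eqP//];
    case/negP: uC'; rewrite memC E !inE ?eqxx ?orbT //.
  by have := mem_last c t; rewrite inE => /orP[]->; rewrite ?orbT.
by rewrite (only_w y) // (only_w z).
Qed.

Let A := ~: [set x in C].

Let inA x : (x \in A) = (x \notin C). Proof. by rewrite !inE. Qed.

(** The edges are counted from their ends on [C], at most one for each vertex. *)
Lemma boundary_cycleC : boundary A <= size C.
Proof.
have -> : boundary A = \sum_(x in A) #|nb x :&: [set x in C]|.
  by apply: eq_bigr => x _; apply: eq_card => y; rewrite !inE negbK andbC.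
rewrite edges_between_sym.
have -> : size C = \sum_(x in [set x in C]) 1.
  case: C_cycle => /andP[_ uC] _; rewrite sum1_card cardsE.
  exact/esym/card_uniqP.
apply: leq_sum => a; rewrite inE => aC.
apply/card_le1_eqP => y z; rewrite !inE => /andP[ay yC] /andP[az zC].
exact: (cycle_outer_nbr aC).
Qed.

(** * Shortest cycle of length at least 5 *)

Hypothesis cyclesA : forall c, graph_cycle adj c -> c \subset A -> size c = size C.
Hypothesis C_ge5 : 5 <= size C.

Let g := size C.

(** Otherwise [x] would have two neighbours on [C], forcing [size C <= 4]. *)
Lemma inner_nbr x a : x \in A -> exists b, [/\ b \in A, adj x b & b != a].
Proof.
move=> xA; have [b /and3P[]|no_b] := pickP [pred b | [&& b \in A, adj x b & b != a]].
  by exists b.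
have /card_gt1P[b [c []]] : 1 < #|nb x :\ a|.
  have := adj_cubic x; rewrite /degree -/(nb x) (cardsD1 a); lia.
rewrite !inE => /andP[ba xb] /andP[ca xc] bc.
have inC u : u != a -> adj x u -> u \in C.
  by move=> ua xu; have := no_b u; rewrite /= inA xu ua !andbT => /negbFE.
have := cycle_touched_twice _ (inC _ ba xb) (inC _ ca xc) bc xb xc.
by rewrite -inA xA => /(_ isT); lia.
Qed.

Lemma square_free x y z w : uniq [:: x; y; z; w] ->
  adj x y -> adj y z -> adj z w -> adj w x -> False.
Proof.
move=> u xy yz zw wx; suff h : graph_cycle adj [:: x; y; z;
  w] by move: (C_shortest h) => /=; lia.
by split=> //; rewrite /ucycle u /= xy yz zw wx.
Qed.

Variable x0 : V.

Let closes s : longest A s -> 0 < size s ->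
  [/\ 2 < g, g <= size s & adj (nth x0 s 0) (nth x0 s g.-1)].
Proof.
move=> sl s0; have [b [bA ab b1]] := inner_nbr (nth x0 s 1) (longest_mem x0 sl s0).
have [_ [bE|[g3 gs bE]]] := longest_head sl cyclesA s0 bA ab adj_irr.
  by rewrite bE eqxx in b1.
by split; rewrite // -bE.
Qed.

(** Another neighbour [y] of [v 1] is either [v g] or, off the path, a possible new head. Both are
    adjacent to [v (g - 1)], so [v 0], [v 1], [y], [v (g - 1)] form a 4-cycle. *)
Lemma second_nbrs s y : longest A s -> 0 < size s -> y \in A ->
  adj (nth x0 s 1) y -> y \in [:: nth x0 s 0; nth x0 s 2].
Proof.
move=> sl s0 yA ay; have [_ gs ag] := closes sl s0.
have [h gE] : exists h, g = h.+4.+1.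
  by exists (g - 5); rewrite -[_.+4.+1]/(5 + _) subnKC.
rewrite gE /= in gs ag.
have s1 : 1 < size s by apply: leq_trans gs.
have s2 : 2 < size s by apply: leq_trans gs.
have vneq i j : i < size s -> j < size s -> i != j -> nth x0 s i != nth x0 s j.
  by move=> ? ?; apply: contra_neq; apply: (longest_inj sl).
have a10 : adj (nth x0 s 1) (nth x0 s 0) by apply: (longest_step x0 sl).
have a12 : adj (nth x0 s 1) (nth x0 s 2) by apply: (longest_step x0 sl).
apply: contraT; rewrite !inE => /norP[y0 y2]; exfalso.
have [ys|ys] := boolP (y \in s).
  have /(nthP x0)[j js jy] := ys; have {}js : j < size s := js.
  rewrite -{y yA ys}jy in ay y0 y2.
  have jg : j = h.+4.+1.
    have := longest_chord sl cyclesA _ js ay; rewrite -/g gE.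
    case: j js ay y0 y2 => [|[|[|j]]] js; rewrite ?eqxx ?adj_irr // => _ _ _.
    by move=> ->.
  rewrite jg in js ay.
  apply: (@square_free (nth x0 s 0) (nth x0 s 1) (nth x0 s h.+4.+1) (nth x0 s h.+4)) =>
    //.
  - have hh : h.+4.+1 != h.+4 by rewrite gtn_eqF.
    by rewrite /= !inE !negb_or !vneq.
  - by rewrite adj_sym.
  - by apply: (longest_step x0 sl); rewrite ?eqxx ?orbT.
  - by rewrite adj_sym.
have wl : longest A (y :: behead s).
  by apply: (longest_swap (x0 := x0) sl); rewrite ?(adj_sym y).
have [//|_ _] := closes wl; rewrite gE /= nth_behead => yg.
apply: (@square_free (nth x0 s 0) (nth x0 s 1) y (nth x0 s h.+4)) => //.
- have yneq i : i < size s -> nth x0 s i != y.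
    by move=> si; apply: contraNneq ys => <-; apply: mem_nth.
  by rewrite /= !inE !negb_or !vneq ?yneq ?(eq_sym y) ?yneq.
- by rewrite adj_sym.
- by rewrite adj_sym.
Qed.

(* Such a vertex has degree at most 2 in [A], hence a neighbour on [C]. *)
Definition inner s i := [/\ i < size s, nth x0 s i \in A & exists a b,
  [/\ a < size s, b < size s & forall y, y \in A -> adj (nth x0 s i) y ->
      y \in [:: nth x0 s a; nth x0 s b]]].

(** Besides the first two vertices of [s], the indices [g - 2] and [g - 3] give the first two after
    the rotation at [g - 1]. *)
Lemma inner_head s i : longest A s -> 0 < size s -> i \in [:: 0; 1; g.-2.-1; g.-2] ->
  inner s i.
Proof.
move=> sl s0 iI; have [_ gs ag] := closes sl s0.
have g5 : 4 < g := C_ge5.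
have gm : 0 < g.-1 < size s by lia.
have i_s : i < size s by move: iI; rewrite !inE => /or4P[]/eqP->; lia.
split=> //; first exact: (longest_mem x0 sl).
have rl := longest_rot sl gm ag.
have r0 : 0 < size (rev (take g.-1 s) ++ drop g.-1 s).
  by rewrite size_cat size_drop; lia.
move: iI; rewrite !inE => /or4P[]/eqP->.
- exists 1, g.-1; split; try lia.
  by move=> y; apply: (longest_end_nbrs cyclesA sl s0).
- exists 0, 2; split; try lia.
  by move=> y; apply: second_nbrs sl s0.
- exists (g.-1 - 1), (g.-1 - 3); split; try lia.
  move=> y yA ay; have := second_nbrs rl r0 yA; rewrite !nth_rot_path; try lia.
  have -> : 0 < g.-1 by lia.
  have -> : 1 < g.-1 by lia.
  have -> : 2 < g.-1 by lia.
  by rewrite subn2; apply.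
- exists g.-1.-2, g.-1; split; try lia.
  by move=> y; apply: (rot_end_nbrs cyclesA closes sl s0).
Qed.

Lemma inner_last s i : longest A s -> 0 < size s -> i \in [:: 0; 1; g.-2.-1; g.-2] ->
  inner s (size s - i.+1).
Proof.
move=> sl s0 iI; have rl := longest_rev sl.
have r0 : 0 < size (rev s) by rewrite size_rev.
have [i_s viA [a [b [a_s b_s H]]]] := inner_head rl r0 iI.
rewrite size_rev in i_s a_s b_s; rewrite !nth_rev // in viA H.
split=> //; first by lia.
by exists (size s - a.+1), (size s - b.+1); split=> //; lia.
Qed.

(** Each listed vertex sends an edge to [C], and at most [g] edges arrive there. *)
Lemma inner_bound s I : longest A s -> uniq I -> (forall i, i \in I -> inner s i) ->
  size I <= g.
Proof.
move=> sl uI hI; rewrite -(size_map (nth x0 s)).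
apply: leq_trans boundary_cycleC; apply: boundary_ge.
  rewrite map_inj_in_uniq // => i j /hI[i_s _ _] /hI[j_s _ _].
  exact: (longest_inj sl).
move=> x /mapP[i /hI[i_s iA [a [b [_ _ H]]]] ->]; split=> //.
exact: nbr_outside H.
Qed.

(* If a longest path of [A] is closed, the rest of [A] supplies one more vertex
   adjacent to [C]. *)
Lemma inner_bound_closed s I : longest A s -> uniq I ->
    (forall i, i \in I -> inner s i) ->
    (forall i, i < size s -> i \notin I ->
      forall y, y \in A -> adj (nth x0 s i) y -> y \in s) ->
  g + size s < #|V| -> size I < g.
Proof.
move=> sl uI hI hs sV.
have sclosed x y : x \in s -> y \in A -> adj x y -> y \in s.
  case/(nthP x0)=> i i_s <- yA; have [/hI[_ _ [a [b [a_s b_s H]]]]|iI] := boolP (i \in I).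
    by move=> /(H _ yA); rewrite !inE => /orP[]/eqP->; apply: mem_nth.
  exact: hs.
pose B := A :\: [set x in s].
have BA : B \subset A by apply: subsetDl.
have [x xB] : exists x, x \in B.
  apply/set0Pn; rewrite -card_gt0 cardsD subn_gt0.
  apply: leq_ltn_trans (subset_leq_card (subsetIr _ _)) _.
  rewrite [X in _ < X]cardsCs setCK !cardsE.
  by rewrite ltn_subRL; apply: leq_ltn_trans sV; apply: leq_add; apply: card_size.
(* The head [w] has at most two neighbours in [B], hence one outside [B]; since no edge inside [A]
   leaves [s], that one is on [C]. *)
have [t tl t0] := exists_longest xB; pose w := nth x0 t 0.
have wB : w \in B by apply: (longest_mem x0 tl t0).
have cyclesB c : graph_cycle adj c -> c \subset B -> size c = g.
  by move=> gc cB; apply: cyclesA gc (subset_trans cB BA).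
have [y yB wy] : exists2 y, y \notin B & adj w y.
  apply: (@nbr_outside _ _ (nth x0 t 1) (nth x0 t g.-1)) => y yB ay; rewrite !inE.
  by have [_ [->|[_ _ ->]]] := longest_head tl cyclesB t0 yB ay adj_irr;
    rewrite eqxx ?orbT.
have [wA ws] : w \in A /\ w \notin s by move: wB; rewrite in_setD inE => /andP[].
have yA : y \notin A.
  apply: contra yB => yA; rewrite in_setD yA inE andbT.
  by apply: contra ws => ys; apply: (sclosed y); rewrite // adj_sym.
rewrite -(size_map (nth x0 s)) -/(size (w :: map (nth x0 s) I)).
apply: leq_trans boundary_cycleC; apply: boundary_ge.
  rewrite /= map_inj_in_uniq ?uI ?andbT; last first.
    by move=> i j /hI[i_s _ _] /hI[j_s _ _]; apply: (longest_inj sl).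
  by apply: contra ws => /mapP[i /hI[i_s _ _] ->]; apply: mem_nth.
move=> u; rewrite inE => /predU1P[->|/mapP[i /hI[i_s iA [a [b [_ _ H]]]] ->]]; split=> //.
  by exists y.
exact: nbr_outside H.
Qed.

(** If [C] contained every vertex, the third edge at its first vertex would be a chord cutting off a
    shorter cycle. *)
Lemma outside_shortest : exists x, x \notin C.
Proof.
have [allC|] := boolP [forall x, x \in C]; last by move/forallPn.
case: C_cycle => /andP[cC uC] C3.
case: C (C_shortest) C_ge5 cC uC allC => //= a t short t4.
rewrite rcons_path => /andP[pat lta] uat /forallP allC.
have spat : path_in [set: V] (a :: t).
  by apply/and3P; split=> //; apply/subsetP=> u; rewrite inE.
have {}t4 : 3 < size t := t4.
have a0 : adj a (nth a t 0) by case: (t) t4 pat => //= b u _ /andP[].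
have a1 : adj a (nth a t (size t).-1) by rewrite nth_last adj_sym.
have n01 : nth a t 0 != nth a t (size t).-1.
  have ut : uniq t by case/andP: uat.
  by rewrite nth_uniq //; case: (size t) t4 => [|[|n]].
have [w [aw w0 w1 _]] := third_nbr a0 a1 n01.
have : w \in a :: t := allC w.
rewrite inE => /predU1P[wa|/(nthP a)[j jt jw]]; first by rewrite wa adj_irr in aw.
have {}jt : j < size t := jt.
rewrite -{}jw in w0 w1 aw.
have j0 : j != 0 by apply: contraNneq w0 => ->.
have j1 : j != (size t).-1 by apply: contraNneq w1 => ->.
have [|c [gc _ cs]] := chord_cycle (x0 := a) spat (i := 0) (j := j.+1) _ jt aw;
  first by rewrite ltnS lt0n.
have := short _ gc; rewrite cs subn0 ltnS => tj; case/negP: j1.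
by have -> : size t = j.+1 by apply/eqP; rewrite eqn_leq tj.
Qed.

Lemma large_girth_small_order : #|V| < 15.
Proof.
rewrite ltnNge; apply/negP=> V15; have g5 : 4 < g := C_ge5.
have [x xA] : exists x, x \in A.
  by have [x xC] := outside_shortest; exists x; rewrite inA.
have [s sl s0] := exists_longest xA.
have [_ gs ag] := closes sl s0.
pose v i := nth x0 s i.
(* The adjacent vertices [v 0] and [v 1] touch [C], and at different vertices by
   [cycle_outer_nbr]. *)
have g6 : g <= 6.
  have touch i : inner s i -> v i \notin C /\ exists2 a, a \in C & adj (v i) a.
    case=> i_s iA [a [b [_ _ H]]]; split; first by rewrite -inA.
    by have [y] := nbr_outside H; rewrite inA negbK; exists y.
  have i0 : 0 \in [:: 0; 1; g.-2.-1; g.-2] by rewrite !inE.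
  have i1 : 1 \in [:: 0; 1; g.-2.-1; g.-2] by rewrite !inE.
  have [v0C [a aC va]] := touch 0 (inner_head sl s0 i0).
  have [v1C [b bC vb]] := touch 1 (inner_head sl s0 i1).
  have s1 : 1 < size s by apply: leq_trans gs; apply: leq_trans g5.
  have v01 : adj (v 0) (v 1) by apply: (longest_step x0 sl).
  apply: (cycle_touched_adj v0C v1C v01 aC bC _ va vb).
  apply: contraTneq isT => ab; rewrite -{b bC}ab in vb.
  have : v 0 = v 1 by apply: (cycle_outer_nbr aC); rewrite ?(adj_sym a).
  by move/(longest_inj sl) => /(_ s0 s1).
have vstep i j : (j == i.+1) || (i == j.+1) -> i < size s -> j < size s ->
  adj (v i) (v j) := @longest_step x0 A s sl i j.
have vneq i j : i < size s -> j < size s -> i != j -> v i != v j.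
  by move=> ? ?; apply: contra_neq; apply: (longest_inj sl).
(* This is the closing chord of the reversed path. *)
have bg : adj (v (size s).-1) (v (size s - g)).
  have r0 : 0 < size (rev s) by rewrite size_rev.
  have [_ _] := closes (longest_rev sl) r0; rewrite !nth_rev; try lia.
  by rewrite subn1 prednK //; lia.
pose near := [:: 0; 1; g.-2.-1; g.-2].
have ends (I J : seq nat) : {subset I <= near} -> {subset J <= near} ->
    forall i, i \in I ++ map (fun i => size s - i.+1) J -> inner s i.
  move=> hI hJ i; rewrite mem_cat => /orP[/hI|/mapP[j /hJ jn ->]].
    exact: inner_head.
  exact: inner_last.
have bound (I J : seq nat) (hI : {subset I <= near}) (hJ : {subset J <= near})
    (u : uniq (I ++ map (fun i => size s - i.+1) J)) :=
  inner_bound sl u (ends _ _ hI hJ).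
have boundc (I J : seq nat) (hI : {subset I <= near}) (hJ : {subset J <= near})
    (u : uniq (I ++ map (fun i => size s - i.+1) J)) :=
  inner_bound_closed sl u (ends _ _ hI hJ).
have n1 y := second_nbrs (y := y) sl s0.
have [gE|gE] : g = 5 \/ g = 6 by lia.
  have sI (I : seq nat) : all (mem [:: 0; 1; 2; 3]) I -> {subset I <= near}.
    by rewrite /near gE; move/allP.
  (* From 6 vertices on, the last two are new and make six inner vertices. With 5, all are inner,
     and the rest of [A] gives the sixth edge. *)
  have [k6|k5] := ltnP 5 (size s).
    have u : uniq ([:: 0; 1; 2; 3] ++ [seq size s - i.+1 | i <- [:: 0; 1]]).
      by rewrite /= !inE; move: (size s) k6 => k k6; clear -k6; lia.
    by have := bound _ _ (sI [:: 0; 1; 2; 3] isT) (sI [:: 0; 1] isT) u; rewrite gE.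
  have ks : size s = 5 by apply/eqP; rewrite eqn_leq k5 -gE gs.
  have := boundc [:: 0; 1; 2; 3] [:: 0] (sI [:: 0; 1; 2; 3] isT) (sI [:: 0] isT).
  rewrite /= ks gE => /(_ isT) b; suff : 5 < 5 by [].
  by apply: b; rewrite ?(leq_trans _ V15) //; do 5![case=> //].
have sI (I : seq nat) : all (mem [:: 0; 1; 3; 4]) I -> {subset I <= near}.
  by rewrite /near gE; move/allP.
(* From 9 vertices on, the last, second last and fourth last are new: seven inner vertices. *)
have [k9|k8] := ltnP 8 (size s).
  have u : uniq ([:: 0; 1; 3; 4] ++ [seq size s - i.+1 | i <- [:: 0; 1; 3]]).
    by rewrite /= !inE; move: (size s) k9 => k k9; clear -k9; lia.
  by have := bound _ _ (sI [:: 0; 1; 3; 4] isT) (sI [:: 0; 1; 3] isT) u; rewrite gE.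
have [ks|[ks|ks]] : size s = 6 \/ size s = 7 \/ size s = 8.
  by move: gs k8; rewrite gE; move: (size s) => k gs k8; clear -gs k8; lia.
(* Counted from the far end, 0 and 3 are the missing indices 5 and 2, so all six vertices are
   inner. *)
- have := boundc [:: 0; 1; 3; 4] [:: 0; 3] (sI [:: 0; 1; 3; 4] isT) (sI [:: 0; 3] isT).
  rewrite /= ks gE => /(_ isT) b; suff : 6 < 6 by [].
  by apply: b; rewrite ?(leq_trans _ V15) //; do 6![case=> //].
(* Here the far closing chord joins [v 6] to [v 1], against [second_nbrs]. *)
- rewrite ks gE /= in bg vneq; have vA : v 6 \in A by apply: (longest_mem x0 sl);
  rewrite ks.
  have := n1 _ vA; rewrite adj_sym => /(_ bg); rewrite -!/(v _) !inE.
  by rewrite !(negPf (vneq _ _ _ _ _)).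
(* Only [v 2] and [v 5] are missing; their third edges are the closing chords to [v 7] and [v 0].
   The order enters as [6 + 8 < 15]. *)
- have := boundc [:: 0; 1; 3; 4] [:: 0; 1] (sI [:: 0; 1; 3; 4] isT) (sI [:: 0; 1] isT).
  rewrite ks gE /= in bg ag vneq vstep *; rewrite -!/(v _) in ag.
  move=> /(_ isT) b; suff : 6 < 6 by [].
  apply: b; rewrite ?(leq_trans _ V15) //.
  case=> [|[|[|[|[|[|[|[|]]]]]]]] // _ _ y _ ay.
  + have : y \in [:: v 1; v 3; v 7].
      apply: (@three_nbrs (v 2));
        [exact: vstep | exact: vstep | by rewrite adj_sym | | exact: ay].
      by rewrite /= !inE !negb_or !vneq.
    by rewrite !inE => /or3P[]/eqP->; apply: mem_nth; rewrite ks.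
  + have : y \in [:: v 0; v 4; v 6].
      apply: (@three_nbrs (v 5));
        [by rewrite adj_sym | exact: vstep | exact: vstep | | exact: ay].
      by rewrite /= !inE !negb_or !vneq.
    by rewrite !inE => /or3P[]/eqP->; apply: mem_nth; rewrite ks.
Qed.

End ShortestCycle.
(** A cycle exists: the head of a longest path has a neighbour besides [v 1], which lies on the
    path. *)
Lemma exists_shortest_cycle (x : V) : exists2 C, graph_cycle adj C &
  forall c, graph_cycle adj c -> size C <= size c.
Proof.
pose P n := [exists t : n.-tuple V, [&& cycle adj t, uniq t & 3 <= n]].
have inP c : graph_cycle adj c -> P (size c).
  by case=> /andP[cc uc] c3; apply/existsP; exists (in_tuple c); rewrite cc uc.
have exP : exists n, P n.
  have [s sl s0] := exists_longest (in_setT x).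
  pose v := nth x s; have [y] : exists2 y, y \notin [set v 1] & adj (v 0) y.
    by apply: (@nbr_outside _ _ (v 1) (v 1)) => w /set1P-> _; rewrite inE eqxx.
  rewrite inE => y1 ay; have /(nthP x)[j js jy] := longest_head_nbr sl s0 (in_setT y) ay.
  rewrite -{}jy in y1 ay.
  have [|c [gc _ _]] := chord_cycle (proj1 sl) (i := 0) _ js ay.
    by case: j js y1 ay => [|[|j]] //= _; rewrite ?eqxx ?adj_irr.
  by exists (size c); apply: inP.
case: (ex_minnP exP) => n /existsP[t /and3P[ct ut n3]] nmin.
by exists t => [|c /inP/nmin]; rewrite ?size_tuple //; split;
  rewrite ?size_tuple // /ucycle ct.
Qed.

End Cubic.
End Paths.

Theorem theorem2p20 (V : finType) (adj : rel V)
    (hG : simple_graph adj) (hcubic : cubic adj) (horder : 15 <= #|V|) :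
  exists c1 c2 : seq V,
    [/\ graph_cycle adj c1, graph_cycle adj c2,
        [disjoint c1 & c2] & size c1 <> size c2].
Proof.
have [adj_sym adj_irr] := hG.
have [[c1 [c2 H]]|no_pair] := classic (exists c1 c2 : seq V,
    [/\ graph_cycle adj c1, graph_cycle adj c2,
        [disjoint c1 & c2] & size c1 <> size c2]).
  by exists c1, c2.
exfalso; have [x0 _] : exists x, x \in [set: V].
  by apply/set0Pn; rewrite -card_gt0 cardsT; apply: leq_trans horder.
have [C C_cycle C_shortest] := exists_shortest_cycle adj_sym adj_irr hcubic x0.
pose A := ~: [set x in C].
have cyclesA c : graph_cycle adj c -> c \subset A -> size c = size C.
  (* A cycle of another length in [A] would form an excluded pair with [C]. *)
  move=> gc cA; have [//|/eqP neq] := eqVneq (size c) (size C).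
  case: no_pair; exists c, C; split=> //.
  by rewrite disjoint_subset; apply: subset_trans cA _; apply/subsetP=> x; rewrite !inE.
have [C4|C5] := leqP (size C) 4; last first.
  have := large_girth_small_order adj_sym adj_irr hcubic C_cycle C_shortest cyclesA C5 x0.
  by rewrite ltnNge horder.
have cA : #|A| + size C >= #|V|.
  by rewrite -(cardsC [set x in C]) addnC leq_add2l cardsE card_size.
have A0 : 0 < #|A|.
  rewrite -(ltn_add2r (size C)); apply: leq_trans cA; apply: leq_trans horder.
  by rewrite ltnS (leq_trans C4).
have := boundary_bound adj_sym adj_irr hcubic C4 cyclesA A0.
have := boundary_cycleC adj_sym hcubic C_cycle; rewrite -/A.
(* Together, [#|V| + 10 <= 6 * size C <= 24]. *)
lia.
Qed.
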